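(* There exists a $(v,8,1)$-RBIBD for each $v\in\{5720,5776,10200,24480\}$.
   Context: A $(v,k,\lambda)$-BIBD is a pair $(V,\mathcal{A})$ where $V$ is a set of $v$ points and $\mathcal{A}$ is a collection of $k$-subsets of $V$ (blocks) such that every $2$-subset of $V$ is contained in exactly $\lambda$ blocks of $\mathcal{A}$. It is resolvable (a $(v,k,\lambda)$-RBIBD) if there exists a partition of $\mathcal{A}$ (a resolution) into parallel classes, each of which is a partition of $V$. *)

(* Defs.v *)
From mathcomp Require Import all_boot.

Set Implicit Arguments.
Unset Strict Implicit.
Unset Printing Implicit Defensive.

(* The point set V is the whole finite type T.  The blocks are a sequence, read
   as a multiset: a collection of blocks may contain repeated blocks. *)
Definition is_BIBD (T : finType) (v k lambda : nat) (A : seq {set T}) : Prop :=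
  [/\ #|T| = v,
      forall B : {set T}, B \in A -> #|B| = k &
      forall S : {set T}, #|S| = 2 ->
        count (fun B : {set T} => S \subset B) A = lambda].

Definition is_parallel_class (T : finType) (P : seq {set T}) : bool :=
  uniq P && partition [set B in P] [set: T].

(* [perm_eq] says that the multiset A is the sum of the classes of R, so each
   occurrence of a block of A lies in exactly one class. *)
Definition is_resolution (T : finType) (A : seq {set T})
    (R : seq (seq {set T})) : Prop :=
  perm_eq (flatten R) A /\
  forall P : seq {set T}, P \in R -> is_parallel_class P.

Definition resolvable (T : finType) (A : seq {set T}) : Prop :=
  exists R : seq (seq {set T}), is_resolution A R.

Definition is_RBIBD (T : finType) (v k lambda : nat) (A : seq {set T}) : Prop :=
  is_BIBD v k lambda A /\ resolvable A.

(* Main.v *)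
From HB Require Import structures.
Require Import Defs.
From mathcomp Require Import all_boot all_algebra all_field.

Set Implicit Arguments.
Unset Strict Implicit.
Unset Printing Implicit Defensive.
Import GRing.Theory.

(** An 8-frame of type [7^n] has [n] groups of 7 points, blocks of size 8
    covering each pair of points from different groups exactly once, and a
    partition of its blocks into [n] classes, the [c]-th of which partitions the
    complement of the [c]-th group.  Adding one point to all the groups turns
    group [c] into a block of size 8 that completes class [c], so an 8-frame of
    type [7^n] yields a [(7n+1,8,1)]-RBIBD ([RBIBD_of_frame7]).  The four orders
    are [7n+1] for [n] = 817, 825, 1457 and 3497.

    A frame is determined by the colouring that sends two points of different
    groups to the class of the block through them.  The constructions are those
    of pairwise balanced designs: replacing the points of a group divisible
    design by groups and its blocks by frames ([frame_wilson], [frame7_pbd]),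
    filling the groups with frames that share one more group ([frame7_fill]),
    and inflating by a difference matrix ([frame_inflate]).

    Write [q] for the order of a field [F].  A transversal design with [q+1]
    groups of size [e], the last of them truncated to [u] points, is weighted by
    8 on its first [q] groups and by [q-1] on the last one.  A block avoiding
    the last group carries a frame of type [7^q] inflated by 8; a block meeting
    it carries the frame obtained from the strip [S * F], with [#|S| = 9] and
    the origin deleted, in the affine plane over [F].  Filling the groups gives
    [n = 8qe + u(q-1) + 1] ([frame7_truncated_td]):
    - [825 = 8*9*11 + 4*8 + 1], from frames of types [7^9], [7^89], [7^33];
    - [1457 = 8*9*19 + 11*8 + 1], from types [7^9], [7^153], [7^89];
    - [3497 = 8*17*25 + 6*16 + 1], from types [7^9], [7^17], [7^201], [7^97].
    Lastly [817 = 17*48 + 1] comes from inflating a frame of type [7^17] by a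
    difference matrix of order 48 and filling the groups with type [7^49].

    The small frames come from difference families, which are verified by
    computation ([frame_of_family]), except that the strip with [#|S| = 9] over
    the field of order 17 gives type [7^153], and that type [7^201] is obtained
    from a frame of type [56^25] by filling its groups with type [7^9]. *)

(** * Frames as edge colourings *)

(** The points are the pairs [(c, i)] with [c] in [S] and [i < 7], the colours
    are the elements of [S], and the groups, of points and of colours alike, are
    the fibres of [h].  Two points in different groups receive a colour from
    outside their groups; the points joined to [x] in colour [c], together with
    [x], form a block, of size 8; and the blocks of colour [c] partition the
    points outside the group of [c].  So this is an 8-frame with, for each group
    of colours of size [m], a group of [7m] points.  The values of [col] on
    points of the same group, or outside [S], are irrelevant.  The frame lives
    on a subset [S] of [C] so that the frames carried by the blocks of a larger
    design can be glued. *)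
Definition frame_on (C I : finType) (S : {set C}) (h : C -> I)
    (col : C * 'I_7 -> C * 'I_7 -> C) : Prop :=
  [/\ forall x y, x.1 \in S -> y.1 \in S -> h x.1 != h y.1 ->
        [/\ col x y \in S, h (col x y) != h x.1 & col y x = col x y],
      forall x y z, x.1 \in S -> y.1 \in S -> z.1 \in S ->
        h x.1 != h y.1 -> h x.1 != h z.1 -> y != z -> col x y = col x z ->
        h y.1 != h z.1 /\ col y z = col x y
    & forall x c, x.1 \in S -> c \in S -> h c != h x.1 ->
        #|[set y | [&& y.1 \in S, h y.1 != h x.1 & col x y == c]]| = 7].

(** Existence of an 8-frame with point set [S * 'I_7] and groups given by [h]. *)
Definition has_frame (C I : finType) (S : {set C}) (h : C -> I) : Prop :=
  exists col, frame_on S h col.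

(** Existence of an 8-frame of type [7^n]: each colour is a group by itself. *)
Definition frame7 (n : nat) : Prop := has_frame [set: 'I_n] id.

Lemma frame_transport (C1 I1 C2 I2 : finType) (h1 : C1 -> I1) (h2 : C2 -> I2)
    (f : C1 -> C2) :
  injective f ->
  (forall c d, (h2 (f c) == h2 (f d)) = (h1 c == h1 d)) ->
  has_frame [set: C1] h1 -> has_frame [set f c | c : C1] h2.
Proof.
move=> f_inj hf [col [A1 A2 A3]].
(* a partial inverse of f *)
pose g d := [pick c | f c == d].
have gK c : g (f c) = Some c.
  rewrite /g; case: pickP => [c' /eqP/f_inj -> //|/(_ c)].
  by rewrite eqxx.
pose col2 (x y : C2 * 'I_7) :=
  if (g x.1, g y.1) is (Some c, Some d) then f (col (c, x.2) (d, y.2)) else x.1.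
have col2E c i d j : col2 (f c, i) (f d, j) = f (col (c, i) (d, j)).
  by rewrite /col2 /= !gK.
exists col2; split.
- move=> [x i] [y j] /= /imsetP[c _ ->] /imsetP[d _ ->].
  rewrite hf => ne; rewrite !col2E.
  have [_ B ->] := A1 (c, i) (d, j) (in_setT _) (in_setT _) ne.
  by rewrite imset_f ?inE // hf.
- move=> [x i] [y j] [z k] /= /imsetP[c _ ->] /imsetP[d _ ->] /imsetP[e _ ->].
  rewrite !hf !col2E => ne1 ne2 ne3 /f_inj Ecol.
  have ne3' : (d, j) != (e, k) by apply: contraNneq ne3 => -[-> ->].
  have [B ->] := A2 (c, i) (d, j) (e, k) (in_setT _) (in_setT _) (in_setT _)
                    ne1 ne2 ne3' Ecol.
  by [].
- move=> [x i] _ /= /imsetP[c _ ->] /imsetP[e _ ->]; rewrite hf => ne.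
  apply: etrans _ (A3 (c, i) e (in_setT _) (in_setT _) ne).
  rewrite -(card_imset _ (_ : injective (fun y : C1 * 'I_7 => (f y.1, y.2)))); last first.
    by move=> [? ?] [? ?] /= [/f_inj -> ->].
  apply: eq_card => -[y j]; rewrite inE /=; apply/idP/imsetP.
    case/and3P=> /imsetP[d _ ->]; rewrite hf col2E => B /eqP/f_inj Ec.
    by exists (d, j); rewrite // !inE /= B Ec eqxx.
  case=> -[d k]; rewrite inE /= => /and3P[_ B /eqP Ec] [-> ->].
  by rewrite imset_f ?inE //= hf B col2E Ec eqxx.
Qed.

Lemma frame7_set (C : finType) (S : {set C}) : frame7 #|S| -> has_frame S id.
Proof.
move=> /(@frame_transport _ _ _ _ _ id (@enum_val _ (mem S)) enum_val_inj) H.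
have -> : S = [set enum_val i | i : 'I_#|S|].
  apply/setP => x; apply/idP/imsetP => [Sx|[i _ ->]]; last exact: enum_valP.
  by exists (enum_rank_in Sx x); rewrite ?enum_rankK_in.
by apply: H => c d; rewrite (inj_eq enum_val_inj).
Qed.

Lemma frame7_of_frame (C I : finType) (h : C -> I) :
  injective h -> has_frame [set: C] h -> frame7 #|C|.
Proof.
move=> h_inj /(@frame_transport _ _ _ _ _ id enum_rank enum_rank_inj) H.
rewrite /frame7; have -> : [set: 'I_#|C|] = [set enum_rank c | c : C].
  by apply/setP => i; rewrite inE -(enum_valK i) imset_f.
by apply: H => c d; rewrite (inj_eq enum_rank_inj) (inj_eq h_inj).
Qed.

(** * Recursive constructions *)

(** Wilson's fundamental construction.  The sets [beta b] are the blocks of a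
    group divisible design on [X] with groups the fibres of [g], and [p] is the
    projection onto [X] of the weighted points: frames on the preimages of the
    blocks, with the fibres of [p] as groups, glue to a frame whose groups are
    the fibres of [g \o p]. *)
Lemma frame_wilson (C X I B : finType) (p : C -> X) (g : X -> I)
    (beta : B -> {set X}) :
  (forall b, {in beta b &, injective g}) ->
  (forall x y, g x != g y -> exists b, (x \in beta b) && (y \in beta b)) ->
  (forall b b' x y, g x != g y -> x \in beta b -> y \in beta b ->
     x \in beta b' -> y \in beta b' -> b = b') ->
  (forall b, has_frame [set c | p c \in beta b] p) ->
  has_frame [set: C] (fun c => g (p c)).
Proof.
move=> ginj ex un /fin_all_exists[col fr].
pose bl x y := [pick b | (x \in beta b) && (y \in beta b)].
have blP x y : g x != g y ->
    exists b, [/\ bl x y = Some b, x \in beta b & y \in beta b].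
  move=> ne; rewrite /bl; case: pickP => [b /andP[]|N]; first by exists b.
  by have [b] := ex x y ne; rewrite N.
have blE b x y : g x != g y -> x \in beta b -> y \in beta b -> bl x y = Some b.
  move=> ne bx by_; have [b' [-> ? ?]] := blP _ _ ne; congr Some.
  exact: un ne _ _ _ _.
have gne b x y : x \in beta b -> y \in beta b -> x != y -> g x != g y.
  by move=> bx by_; apply: contraNneq => /(ginj b) ->.
have gp x y : g x != g y -> x != y by apply: contraNneq => ->.
pose col0 (x y : C * 'I_7) :=
  if bl (p x.1) (p y.1) is Some b then col b x y else x.1.
exists col0; split.
- move=> x y _ _ ne; have [b [Eb bx by_]] := blP _ _ ne.
  have Eb' : bl (p y.1) (p x.1) = Some b by apply: blE => //; rewrite eq_sym.
  have [A1 _ _] := fr b.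
  have [|||] := A1 x y; rewrite ?inE //; first exact: gp.
  move=> C1 C2 C3.
  rewrite /col0 Eb Eb' C3; split=> //; exact: (gne b).
- move=> x y z _ _ _ ne1 ne2 ne3.
  have [b [Eb bx by_]] := blP _ _ ne1; have [b' [Eb' bx' bz]] := blP _ _ ne2.
  have [A1 A2 _] := fr b; have [A1' _ _] := fr b'.
  rewrite /col0 Eb Eb' => Ec.
  have [|||] := A1 x y; rewrite ?inE //; first exact: gp.
  move=> C1 C2 C3.
  have [|||] := A1' x z; rewrite ?inE //; first exact: gp.
  move=> C1' _ _.
  have Ebb : b = b'.
    apply: (un b b' (p x.1) (p (col b x y))) => //; last by rewrite Ec.
    by rewrite eq_sym; apply: (gne b).
  subst b'; have [|||||||] := A2 x y z; rewrite ?inE //; try exact: gp.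
  move=> D1 D2.
  by rewrite (blE b) // (gne b).
- move=> x c _ _ ne; have [b [Eb bc bx]] := blP _ _ ne.
  have [A1 A2 A3] := fr b; apply: etrans (A3 x c _ _ _); rewrite ?inE //; last exact: gp.
  apply: eq_card => y; rewrite !inE /=; apply/idP/idP.
    case/andP=> ne' /eqP; rewrite /col0.
    have ne2 : g (p x.1) != g (p y.1) by rewrite eq_sym.
    have [b' [Eb' bx' by_]] := blP _ _ ne2.
    rewrite Eb' => Ec; have [A1' _ _] := fr b'.
    have [|||] := A1' x y; rewrite ?inE //; first exact: gp.
    move=> C1 C2 C3.
    have Ebb : b = b'.
      by apply: (un b b' (p c) (p x.1)) => //; rewrite -Ec.
    by subst b'; rewrite by_ Ec eqxx andbT; apply: gp.
  case/and3P=> by_ ne' /eqP Ec.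
  have ne2 : g (p y.1) != g (p x.1) by apply: (gne b).
  by rewrite ne2 /col0 (blE b) ?Ec ?eqxx // eq_sym.
Qed.

(** The set of the [n] for which there is a frame of type [7^n] is PBD-closed. *)
Lemma frame7_pbd (X B : finType) (beta : B -> {set X}) :
  (forall x y, x != y -> exists b, (x \in beta b) && (y \in beta b)) ->
  (forall b b' x y, x != y -> x \in beta b -> y \in beta b ->
     x \in beta b' -> y \in beta b' -> b = b') ->
  (forall b, frame7 #|beta b|) -> frame7 #|X|.
Proof.
move=> ex un fr; apply: (@frame7_of_frame X X id) => //.
apply: (@frame_wilson X X X B id id beta) => // b; first by move=> x y.
rewrite (_ : [set _ | _] = beta b); first exact: frame7_set.
by apply/setP => c; rewrite inE.
Qed.

(** Each group is filled with a frame having one further group of 7 points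
    ([None]), which is common to all of them. *)
Lemma frame7_fill (C I : finType) (h : C -> I) :
  has_frame [set: C] h -> (forall i, frame7 #|[set c | h c == i]|.+1) ->
  frame7 #|C|.+1.
Proof.
move=> [col [A1 A2 A3]] fr; rewrite -card_option.
pose S i : {set option C} := None |: [set Some c | c in [set c | h c == i]].
have SS i c : (Some c \in S i) = (h c == i).
  by rewrite !inE /= mem_imset ?inE //; apply: Some_inj.
have SN i : None \in S i by rewrite !inE.
have {fr} frS i : has_frame (S i) id.
  apply: frame7_set; rewrite /S cardsU1 card_imset; last exact: Some_inj.
  by rewrite (_ : None \notin _) //; apply/imsetP => -[].
have [cl fr] := fin_all_exists frS.
(* The colour None may occur inside every group; a colour Some c occurs between
   points of a group i only when c lies in i. *)
pose col0 (x y : option C * 'I_7) : option C :=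
  match x.1, y.1 with
  | Some c, Some d =>
    if h c == h d then cl (h c) x y else Some (col (c, x.2) (d, y.2))
  | Some c, None => cl (h c) x y
  | None, Some d => cl (h d) x y
  | None, None => None
  end.
apply: (@frame7_of_frame _ _ id) => //; exists col0; split.
- move=> x y _ _ ne; rewrite inE.
  have K i : x.1 \in S i -> y.1 \in S i -> cl i x y != x.1 /\ cl i y x = cl i x y.
    by have [B1 _ _] := fr i; move=> Sx Sy; have [] := B1 x y Sx Sy ne.
  case: x y ne K => [[c|] i] [[d|] j] //= ne K; rewrite /col0 /=.
  + rewrite (eq_sym (h d)); have [e|n] := boolP (h c == h d).
      by rewrite -(eqP e); have [||-> ->] := K (h c); rewrite ?SS -?(eqP e).
    have [_ C2 ->] := A1 (c, i) (d, j) (in_setT _) (in_setT _) n; split=> //.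
    by apply: contraNneq C2 => -[->].
  + by have [||-> ->] := K (h c); rewrite ?SS ?SN.
  + by have [||-> ->] := K (h d); rewrite ?SS ?SN.
- have K i x u y v z w : x \in S i -> y \in S i -> z \in S i ->
      x != y -> x != z -> (y, v) != (z, w) ->
      cl i (x, u) (y, v) = cl i (x, u) (z, w) ->
      y != z /\ cl i (y, v) (z, w) = cl i (x, u) (y, v).
    have [_ B2 _] := fr i; move=> ? ? ? ? ? ?.
    exact: (B2 (x, u) (y, v) (z, w)).
  have K1 i x u y v : x \in S i -> y \in S i -> x != y ->
      cl i (x, u) (y, v) \in S i /\ cl i (x, u) (y, v) != x.
    by have [B1 _ _] := fr i; move=> Sx Sy n; have [] := B1 (x, u) (y, v) Sx Sy n.
  have SSc c : Some c \in S (h c) by rewrite SS.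
  have out c i d j e k : h c != h d -> Some (col (c, i) (d, j)) = cl (h c) (Some c, i) (e, k) ->
      e \in S (h c) -> Some c != e -> False.
    move=> n1 Ec Se ne; have [C1 _] := K1 (h c) _ i _ k (SSc c) Se ne.
    have [_ C2 _] := A1 (c, i) (d, j) (in_setT _) (in_setT _) n1.
    by rewrite -Ec SS (negPf C2) in C1.
  move=> [[c|] i] [[d|] j] [[e|] k] _ _ _ //= ne1 ne2 ne3; rewrite /col0 /=.
  + have [e1|n1] := boolP (h c == h d); have [e2|n2] := boolP (h c == h e).
    * rewrite -(eqP e1) e2 => Ec.
      by apply: K Ec => //; rewrite SS -?(eqP e1) -?(eqP e2).
    * by move=> /esym /out[] //; rewrite SS -(eqP e1).
    * by move=> /out[] //; rewrite SS -(eqP e2).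
    * case=> Ec; have ne3' : (d, j) != (e, k) by apply: contraNneq ne3 => -[-> ->].
      have [C1 C2] := A2 (c, i) (d, j) (e, k) (in_setT _) (in_setT _) (in_setT _)
                         n1 n2 ne3' Ec.
      by rewrite (negPf C1) C2; split=> //; apply: contraNneq C1 => -[->].
  + have [e1|n1] := boolP (h c == h d); last by move=> /out[].
    rewrite -(eqP e1) => Ec.
    by apply: (K (h c) (Some c) i (Some d) j None k) => //; rewrite SS -(eqP e1).
  + have [e2|n2] := boolP (h c == h e); last by move=> /esym /out[].
    rewrite -(eqP e2) => Ec.
    by apply: (K (h c) (Some c) i None j (Some e) k) => //; rewrite SS -(eqP e2).
  + by case/(K (h c) (Some c) i None j None k (SSc c) (SN _) (SN _) ne1 ne2 ne3).
  + move=> Ec; have [C1 D1] := K1 (h d) _ i _ j (SN _) (SSc d) ne1.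
    have [C2 D2] := K1 (h e) _ i _ k (SN _) (SSc e) ne2.
    have Ede : h d = h e.
      case E: (cl _ _ _) C1 D1 C2 Ec => [c|] // C1 _ C2 Ec; move: C1 C2.
      by rewrite -Ec !SS => /eqP <- /eqP.
    rewrite Ede eqxx in Ec *.
    by apply: K Ec => //; rewrite SS Ede.
- have K i x c : x.1 \in S i -> c \in S i -> c != x.1 ->
      #|[set y | [&& y.1 \in S i, y.1 != x.1 & cl i x y == c]]| = 7.
    by have [_ _ B3] := fr i; apply: B3.
  have K1 i x y : x.1 \in S i -> y.1 \in S i -> x.1 != y.1 ->
      cl i x y \in S i /\ cl i x y != x.1.
    by have [B1 _ _] := fr i; move=> ? ? n; have [] := B1 x y _ _ n.
  have K2 i x c : x.1 \in S i -> c \in S i -> c != x.1 ->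
      (forall y, y.1 != x.1 -> col0 x y = c -> y.1 \in S i) ->
      (forall y, y.1 != x.1 -> y.1 \in S i -> col0 x y = cl i x y) ->
      #|[set y | [&& y.1 \in setT, id y.1 != id x.1 & col0 x y == c]]| = 7.
    move=> Sx Sc ne H1 H2; apply: etrans _ (K i x c Sx Sc ne); apply: eq_card => y.
    rewrite !inE /=; have [//|n1] := eqVneq; rewrite ?andbF //=.
    have [Sy|nSy] := boolP (y.1 \in S i); first by rewrite H2 // ; move: Sy; rewrite !inE => ->.
    move: (nSy); rewrite !inE => /negPf ->; apply/negbTE; apply: contra nSy.
    by move=> /eqP; apply: H1.
  have SSc c : Some c \in S (h c) by rewrite SS.
  move=> [[c|] i] [e|] _ _ // ne.
  + have [e1|n1] := boolP (h e == h c).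
      apply: (K2 (h c)); rewrite ?SS //= => -[[d|] j] //= ned; rewrite ?SS ?SN //.
        rewrite /col0 /= [h d == _]eq_sym; have [//|n2 [Ec]] := boolP (h c == h d).
        have [_ C2 _] := A1 (c, i) (d, j) (in_setT _) (in_setT _) n2.
        by move: C2; rewrite Ec (eqP e1) eqxx.
      by rewrite /col0 /= [h d == _]eq_sym => ->.
    have notin y : y.1 \in S (h c) -> Some c != y.1 -> cl (h c) (Some c, i) y <> Some e.
      move=> Sy ny Ec; have [C1 _] := K1 (h c) (Some c, i) y (SSc c) Sy ny.
      by rewrite Ec SS (negPf n1) in C1.
    apply: etrans _ (A3 (c, i) e (in_setT _) (in_setT _) n1).
    rewrite -(card_imset _ (_ : injective (fun y : C * 'I_7 => (Some y.1, y.2)))); last first.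
      by move=> [? ?] [? ?] /= [-> ->].
    apply: eq_card => -[y j]; rewrite !inE /=; apply/idP/imsetP.
      case: y => [d|]; rewrite /col0 /=; last first.
        by move/eqP/notin => N; case: N; rewrite ?SN.
      case/andP=> ned /eqP.
      have [e2|n2 [Ec]] := boolP (h c == h d).
        by move/notin => N; case: N; rewrite ?SS ?(eqP e2) // eq_sym.
      by exists (d, j); rewrite // !inE /= eq_sym n2 Ec eqxx.
    case=> -[d k]; rewrite !inE /= => /andP[n2 /eqP Ec] [-> ->].
    rewrite /col0 /= eq_sym in n2 *; rewrite (negPf n2) Ec eqxx andbT.
    by apply: contraNneq n2 => -[->].
  + apply: (K2 (h c)); rewrite ?SS ?SN // => -[[d|] j] //= ned; rewrite ?SS ?SN //.
      by rewrite /col0 /= [h d == _]eq_sym; case: ifP.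
    by rewrite /col0 /= [h d == _]eq_sym => ->.
  + apply: (K2 (h e)); rewrite ?SS ?SN // => -[[d|] j] //= ned; rewrite ?SS ?SN //.
      rewrite /col0 /= => Ec.
      have [C1 _] := K1 (h d) (None, i) (Some d, j) (SN _) (SSc d) isT.
      by rewrite Ec SS eq_sym in C1.
    by rewrite /col0 /= => /eqP ->.
Qed.

(** Inflation by a difference matrix [D] with 8 rows over [G].  The points of
    each block of the given frame are numbered by [pos], and are replaced by
    copies of [G]; the new blocks above an old one are the translates of the
    columns of [D], and the class of such a block records the column. *)
Lemma frame_inflate (I : finType) (G : finZmodType) (D : 'I_8 -> G -> G) :
  (forall r r', r != r' -> injective (fun s => D r s - D r' s)%R) ->
  has_frame [set: I] id -> has_frame [set: I * G] fst.
Proof.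
move=> Dinj [col [A1 A2 A3]].
pose solve r r' g := odflt 0%R [pick s | D r s - D r' s == g]%R.
have solveP r r' g : r != r' -> (D r (solve r r' g) - D r' (solve r r' g) = g)%R.
  move=> ne; rewrite /solve; case: pickP => [s /eqP //|N].
  have [f fK fK'] := injF_bij (Dinj _ _ ne).
  by have := N (f g); rewrite fK' eqxx.
have solveE r r' s : r != r' -> solve r r' (D r s - D r' s)%R = s.
  by move=> ne; apply: (Dinj _ _ ne); apply: solveP.
pose blk c (x : I * 'I_7) : {set I * 'I_7} :=
  x |: [set y | [&& y.1 \in setT, x.1 != y.1 & col x y == c]].
have blkx c x : x \in blk c x by rewrite !inE eqxx.
have blky x y : x.1 != y.1 -> y \in blk (col x y) x.
  by move=> ne; rewrite !inE ne eqxx orbT.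
have card_blk c x : c != x.1 -> #|blk c x| = 8.
  move=> ne; rewrite cardsU1 !inE eqxx /=; congr _.+1.
  apply: etrans _ (A3 x c (in_setT _) (in_setT _) ne).
  by apply: eq_card => y; rewrite !inE eq_sym.
have blkE x y : x.1 != y.1 -> blk (col x y) y = blk (col x y) x.
  move=> ne; have ne' : y.1 != x.1 by rewrite eq_sym.
  have [_ C2 C3] := A1 x y (in_setT _) (in_setT _) ne.
  apply/setP => z; rewrite !inE /=.
  have [->|nzx] := eqVneq z x; first by rewrite ne' C3 !eqxx orbT.
  have [->|nzy] := eqVneq z y; first by rewrite ne !eqxx.
  rewrite eq_sym in nzx; rewrite eq_sym in nzy.
  apply/idP/idP => /andP[n1 /eqP E1].
    have [] := A2 y x z (in_setT _) (in_setT _) (in_setT _) ne' n1 nzx; first by rewrite E1 C3.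
    by move=> -> ->; rewrite C3 eqxx.
  have [] := A2 x y z (in_setT _) (in_setT _) (in_setT _) ne n1 nzy; first by rewrite E1.
  by move=> -> ->; rewrite eqxx.
(* the rank of x in its block of colour c *)
pose pos c x : 'I_8 := inord (index x (enum (blk c x))).
have pos_inj x y : x.1 != y.1 -> pos (col x y) x != pos (col x y) y.
  move=> ne; have ne' : x != y by apply: contraNneq ne => ->.
  have [_ C2 _] := A1 x y (in_setT _) (in_setT _) ne.
  apply: contraNneq ne' => /(congr1 (@nat_of_ord 8)); rewrite /pos blkE //.
  rewrite !inordK -?(card_blk _ _ C2) ?cardE ?index_mem ?mem_enum ?blkx ?blky //.
  move=> E; have := nth_index x (_ : x \in enum (blk (col x y) x)).
  by rewrite mem_enum E => <- //; rewrite nth_index // mem_enum blky.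
have sub_sub (a b c x y z : G) : (a - b = x - y -> a - c = x - z -> b - c = y - z)%R.
  by move=> h1 h2; rewrite -(subrKA a b) -(opprB a b) h1 h2 opprB subrKA.
pose P (X : I * G * 'I_7) : I * 'I_7 := (X.1.1, X.2).
pose col0 (X Y : I * G * 'I_7) : I * G :=
  let c := col (P X) (P Y) in
  (c, solve (pos c (P X)) (pos c (P Y)) (X.1.2 - Y.1.2)%R).
exists col0; split.
- move=> X Y _ _ ne; have [_ C2 C3] := A1 (P X) (P Y) (in_setT _) (in_setT _) ne.
  rewrite inE; split=> //; rewrite /col0 C3; congr pair.
  have np := pos_inj (P X) (P Y) ne; have np' := np; rewrite eq_sym in np'.
  rewrite -[RHS](solveE _ _ _ np'); congr solve.
  by rewrite -[RHS]opprB solveP // opprB.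
- move=> X Y Z _ _ _ ne1 ne2 ne3 [Ec Es].
  have np1 := pos_inj (P X) (P Y) ne1; have np2 := pos_inj (P X) (P Z) ne2.
  have S1 := solveP _ _ (X.1.2 - Y.1.2)%R np1.
  have S2 := solveP _ _ (X.1.2 - Z.1.2)%R np2.
  rewrite -Es -Ec in S2; rewrite -Ec in np2.
  have S3 : (D (pos (col (P X) (P Y)) (P Y)) (col0 X Y).2 -
             D (pos (col (P X) (P Y)) (P Z)) (col0 X Y).2 = Y.1.2 - Z.1.2)%R.
    exact: sub_sub S1 S2.
  have nP : P Y != P Z.
    apply: contraNneq ne3 => E; move: S3; rewrite E subrr => /esym/eqP.
    rewrite subr_eq0 => /eqP E2; case: E.
    case: Y Z E2 {ne1 ne2 Ec Es np1 np2 S1 S2} => [[? ?] ?] [[? ?] ?] /=.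
    by move=> -> -> ->.
  have [D1 D2] := A2 (P X) (P Y) (P Z) (in_setT _) (in_setT _) (in_setT _) ne1 ne2 nP Ec.
  split=> //; rewrite /col0 D2; congr pair; rewrite -S3.
  by apply: solveE; have := pos_inj (P Y) (P Z) D1; rewrite D2.
- move=> X [c s] _ _ /= ne.
  apply: etrans _ (A3 (P X) c (in_setT _) (in_setT _) ne).
  pose f (y : I * 'I_7) : I * G * 'I_7 :=
    (y.1, X.1.2 - (D (pos c (P X)) s - D (pos c y) s), y.2)%R.
  rewrite -(card_imset _ (_ : injective f)); last by move=> [? ?] [? ?] [-> _ ->].
  apply: eq_card => Y; rewrite !inE /=; apply/idP/imsetP.
    case/andP=> ne1 /eqP[Ec Es]; exists (P Y); first by rewrite !inE ne1 Ec eqxx.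
    have ne1' : (P X).1 != (P Y).1 by rewrite eq_sym.
    have := solveP _ _ (X.1.2 - Y.1.2)%R (pos_inj _ _ ne1'); rewrite Es Ec /f => ->.
    by rewrite subKr; case: Y {ne1 Ec Es ne1'} => -[].
  case=> y; rewrite !inE /= => /andP[ne1 /eqP Ec] ->; rewrite ne1 /=.
  have ne1' : (P X).1 != y.1 by rewrite eq_sym.
  have np := pos_inj _ _ ne1'.
  have Py : P (f y) = y by case: (y).
  by rewrite /col0 Py Ec in np *; rewrite subKr solveE ?eqxx.
Qed.

(** * From frames to resolvable designs *)

(** The extra point is [None]; the parallel class attached to [c] consists of
    the group of [c] completed by [None] and of the blocks of colour [c]. *)
Lemma RBIBD_of_frame7 (n : nat) :
  frame7 n -> exists (T : finType) (A : seq {set T}), is_RBIBD (7 * n).+1 8 1 A.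
Proof.
move=> [col [A1 A2 A3]].
pose T : finType := option ('I_n * 'I_7).
pose hole (c : 'I_n) (p : T) := if p is Some y then y.1 == c else true.
(* p and q lie in the same block of the parallel class c *)
pose r c (p q : T) := if hole c p then hole c q else
  (p == q) || (if (p, q) is (Some y, Some z)
               then (y.1 != z.1) && (col y z == c) else false).
pose B c p := [set q | r c p q].
have rxx c p : r c p p by rewrite /r; case: ifP => // _; rewrite eqxx.
have rB c p q : r c p q -> B c q = B c p.
  have [hp|hp] := boolP (hole c p); rewrite /r ?hp ?(negPf hp).
    by move=> hq; apply/setP => t; rewrite !inE /r hp hq.
  case/orP=> [/eqP -> //|]; case: p q hp => [y|] // [z|] //= hp /andP[ne /eqP Ec].
  have [_ C2 C3] := A1 y z (in_setT _) (in_setT _) ne.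
  have ne' : z.1 != y.1 by rewrite eq_sym.
  have [_ C2' _] := A1 z y (in_setT _) (in_setT _) ne'.
  rewrite C3 Ec in C2'; rewrite Ec in C2 C3.
  apply/setP => t; rewrite !inE /r /= (negPf hp) eq_sym (negPf C2').
  case: t => [t|] //=; rewrite !(inj_eq (@Some_inj _)).
  have [<-|nzt] := eqVneq z t; first by rewrite ne Ec !eqxx orbT.
  have [<-|nyt] := eqVneq y t; first by rewrite ne' C3 !eqxx orbT.
  apply/idP/idP => /andP[n1 /eqP E1].
    have [] := A2 z y t (in_setT _) (in_setT _) (in_setT _) ne' n1 nyt; first by rewrite C3.
    by move=> -> ->; rewrite C3 eqxx.
  have [] := A2 y z t (in_setT _) (in_setT _) (in_setT _) ne n1 nzt; first by rewrite Ec.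
  by move=> -> ->; rewrite Ec eqxx.
have cardB c p : #|B c p| = 8.
  have [hp|hp] := boolP (hole c p).
    have -> : B c p = None |: [set Some y | y in setX [set c] [set: 'I_7]].
      apply/setP => -[t|]; rewrite !inE /r hp //= mem_imset; last exact: Some_inj.
      by rewrite !inE andbT.
    rewrite cardsU1 card_imset; last exact: Some_inj.
    rewrite cardsX cards1 cardsT card_ord (_ : None \notin _) //.
    by apply/imsetP => -[].
  case: p hp => [y|] //= hp.
  have -> : B c (Some y) = Some y |:
      [set Some z | z in [set z | [&& z.1 \in setT, z.1 != y.1 & col y z == c]]].
    apply/setP => -[t|]; rewrite !inE /r /= (negPf hp) ?orbF //=.
      rewrite mem_imset; last exact: Some_inj.
      by rewrite !inE /= (eq_sym t.1) (inj_eq (@Some_inj _)) eq_sym.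
    by apply/esym/imsetP => -[].
  rewrite cardsU1 card_imset; last exact: Some_inj.
  rewrite eq_sym in hp; rewrite (A3 y c) // mem_imset; last exact: Some_inj.
  by rewrite !inE eqxx.
pose P c := [set B c p | p : T].
have memP c S p : S \in P c -> p \in S -> S = B c p.
  by case/imsetP=> q _ ->; rewrite inE => /rB ->.
have partP c : partition (P c) [set: T].
  apply/and3P; split.
  - apply/eqP/setP => p; rewrite inE; apply/bigcupP.
    by exists (B c p); rewrite ?inE // imset_f.
  - apply/trivIsetP => S S' SP SP' /eqP nS; apply/pred0P => p /=.
    by apply/negP => /andP[/(memP c _ _ SP) E1 /(memP c _ _ SP') E2]; apply: nS; rewrite E1 E2.
  - by apply/imsetP => -[p _ E]; have := rxx c p; rewrite -[r _ _ _]in_set -/(B c p) -E inE.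
exists T, (flatten [seq enum (P c) | c <- enum 'I_n]); split; last first.
  exists [seq enum (P c) | c <- enum 'I_n]; split=> // S /mapP[c _ ->].
  rewrite /is_parallel_class enum_uniq /=.
  by rewrite (_ : [set _ in _] = P c) //; apply/setP => S'; rewrite inE mem_enum.
split.
- by rewrite card_option card_prod !card_ord mulnC.
- move=> S /flattenP[_ /mapP[c _ ->]]; rewrite mem_enum => /imsetP[p _ ->].
  exact: cardB.
- move=> S /eqP/cards2P[p [q [npq ->]]].
  rewrite count_flatten -map_comp sumnE big_map big_enum /=.
  have cnt c : count (fun S : {set T} => [set p; q] \subset S) (enum (P c)) = r c p q.
    rewrite -sum1_count big_enum_cond /= sum1dep_card.
    transitivity #|[set S | (S == B c p) && r c p q]|.
      apply: eq_card => S'; rewrite !inE subUset !sub1set.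
      apply/andP/andP => [[SP /andP[/(memP _ _ _ SP) -> ]]|[/eqP-> h]].
        by rewrite inE eqxx.
      by rewrite imset_f // !inE rxx h.
    case: (r c p q); last by apply/eqP; rewrite cards_eq0; apply/eqP/setP => S'; rewrite !inE andbF.
    by rewrite -[RHS](cards1 (B c p)); apply: eq_card => S'; rewrite !inE andbT.
  (* two points lie in a common block of exactly one parallel class *)
  have [c0 rE] : exists c0, forall c, r c p q = (c == c0).
    case: p q npq {cnt} => [y|] [z|] // ne.
    + have [e|nyz] := eqVneq y.1 z.1.
        exists y.1 => c; rewrite /r /= -e (eq_sym c).
        by case: eqP => // _; rewrite eqxx orbF (negPf ne).
      exists (col y z) => c; rewrite /r /= (negPf ne) nyz /= (eq_sym c).
      have [_ C2 C3] := A1 y z (in_setT _) (in_setT _) nyz.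
      have [_ C2' _] := A1 z y (in_setT _) (in_setT _) (contra_neq esym nyz).
      rewrite C3 in C2'; have [<-|//] := eqVneq y.1 c.
      by rewrite (negPf C2) eq_sym (negPf nyz).
    + by exists y.1 => c; rewrite /r /= eq_sym; case: eqP.
    + by exists z.1 => c; rewrite /r /= eq_sym.
  rewrite (eq_bigr (fun c => (c == c0) : nat)) => [|c _]; last by rewrite -rE -cnt.
  by rewrite (bigD1 c0) //= eqxx big1 // => c /negPf ->.
Qed.

(** * Frames from difference families *)

Lemma uniq_map_inj (A B : eqType) (f : A -> B) (s : seq A) :
  uniq (map f s) -> {in s &, injective f}.
Proof.
elim: s => [|a s IH] //= /andP[nfa us] x y; rewrite !inE.
case/predU1P=> [->|xs] /predU1P[->|ys] // E; last exact: IH.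
- by rewrite E map_f in nfa.
- by rewrite -E map_f in nfa.
Qed.

(** The group [H * K] acts by translation on the points [T * H * K], the groups
    of the frame being the sets [T * H * {k}].  A family is a
    sequence of base blocks, each with a label in [L]; the translates of the
    blocks labelled [l] by [H * {t}] are to form the class [(l, t)]. *)
Section DifferenceFamily.
Variables (T : eqType) (H K : zmodType) (L : eqType).
Implicit Types (b : L * seq (T * H * K)) (d f : T * H * K).

(** The ordered pairs of distinct entries of a base block. *)
Definition block_pairs b := [seq p <- [seq (d, f) | d <- b.2, f <- b.2] | p.1 != p.2].

(** The orbit of a pair of points under translation. *)
Definition entry_diff (p : (T * H * K) * (T * H * K)) : T * T * H * K :=
  (p.1.1.1, p.2.1.1, p.1.1.2 - p.2.1.2, p.1.2 - p.2.2)%R.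

Definition family_pairs (dat : seq (L * seq (T * H * K))) :=
  [seq (b, p) | b <- dat, p <- block_pairs b].

Definition family_entries (dat : seq (L * seq (T * H * K))) :=
  [seq (b, d) | b <- dat, d <- b.2].

Definition diff_key (t : (L * seq (T * H * K)) * ((T * H * K) * (T * H * K))) :=
  entry_diff t.2.

(** What matters of an entry, [H] acting transitively on the second component,
    for the blocks of one label to partition the points outside a group. *)
Definition entry_key (t : (L * seq (T * H * K)) * (T * H * K)) : L * T * K :=
  (t.1.1, t.2.1.1, t.2.2).

(** The blocks have size 8, the [nd] differences are distinct and those in [K]
    are nonzero, and likewise the [nl] triples of a label, a component in [T]
    and a nonzero component in [K].  For the right values of [nd] and [nl] these
    conditions say that every possible value occurs exactly once. *)
Definition frame_family (nd nl : nat) (dat : seq (L * seq (T * H * K))) : bool :=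
  [&& all (fun b => (size b.2 == 8) && uniq b.2) dat,
      uniq (map diff_key (family_pairs dat)),
      all (fun t => t.2 != 0%R) (map diff_key (family_pairs dat)),
      size (family_pairs dat) == nd,
      uniq (map entry_key (family_entries dat)),
      all (fun t => t.2 != 0%R) (map entry_key (family_entries dat)) &
      size (family_entries dat) == nl].

End DifferenceFamily.

Lemma uniq_all_card (A : finType) (P : pred A) (s : seq A) :
  uniq s -> all P s -> size s = #|P| -> s =i P.
Proof.
move=> us /allP sP sz x.
have sub : {subset s <= enum P} by move=> y /sP; rewrite mem_enum.
have le : size (enum P) <= size s by rewrite -cardE sz.
by have [_ ->] := uniq_min_size us sub le; rewrite mem_enum.
Qed.

(** The colour of two points is [(l, t)] when the unique pair of entries with
    their difference lies in a block labelled [l] and is translated by [t] in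
    [K]. *)
Lemma frame_of_family (T : finType) (H K : finZmodType) (L : finType)
    (e : L * 'I_7 -> T * H) (dat : seq (L * seq (T * H * K))) :
  bijective e ->
  frame_family (#|T| * #|T| * #|H| * #|K|.-1) (#|L| * #|T| * #|K|.-1) dat ->
  has_frame [set: L * K] snd.
Proof.
move=> [e' eK eK'] /and5P[/allP sz8 uD nD /eqP zD /and3P[uE nE /eqP zE]].
have card0 (A : finType) : #|[pred d : A * K | d.2 != 0%R]| = #|A| * #|K|.-1.
  have -> : #|[pred d : A * K | d.2 != 0%R]| = #|setX [set: A] [set~ (0 : K)%R]|.
    by apply: eq_card => d; rewrite !inE.
  by rewrite cardsX cardsT cardsC1.
have fullD := uniq_all_card uD nD; rewrite size_map zD card0 !card_prod in fullD.
have {}fullD := fullD erefl.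
have fullE := uniq_all_card uE nE; rewrite size_map zE card0 !card_prod in fullE.
have {}fullE := fullE erefl.
have injD := uniq_map_inj uD; have injE := uniq_map_inj uE.
have pairP b d f : (b, (d, f)) \in family_pairs dat = [&& b \in dat, d \in b.2, f \in b.2 & d != f].
  apply/allpairsPdep/and4P => [[b' [[d' f'] [Db]]]|[Db Dd Df ne]].
    rewrite mem_filter => /andP[/= ne /allpairsP[[d2 f2] [/= D1 D2 [E1 E2]]]] [-> -> ->].
    by rewrite -E1 -E2 in D1 D2; split.
  exists b, (d, f); split=> //; rewrite mem_filter ne.
  by apply/allpairsP; exists (d, f).
have entP b d : (b, d) \in family_entries dat = (b \in dat) && (d \in b.2).
  apply/allpairsPdep/andP => [[b' [d' [Db Dd [-> ->]]]] //|[Db Dd]].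
  by exists b, d.
have kne b d f : b \in dat -> d \in b.2 -> f \in b.2 -> d != f -> d.2 != f.2.
  move=> Db Dd Df ne; rewrite -subr_eq0.
  apply: (allP nD (entry_diff (d, f))); apply/mapP.
  by exists (b, (d, f)); rewrite ?pairP ?Db ?Dd ?Df.
have kn0 b d : b \in dat -> d \in b.2 -> d.2 != 0%R.
  move=> Db Dd; apply: (allP nE (b.1, d.1.1, d.2)); apply/mapP.
  by exists (b, d); rewrite // entP Db.
have sub_sub (G : zmodType) (a b c x y z : G) :
    (a - b = x - y -> a - c = x - z -> b - c = y - z)%R.
  by move=> h1 h2; rewrite -(subrKA a b) -(opprB a b) h1 h2 opprB subrKA.
have sub_swap (G : zmodType) (a b x y : G) : (a - b = x - y -> x - a = y - b)%R.
  by move=> E; rewrite -[x](subrK y) -E addrC -addrA addKr addrC.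
(* the components of a point in T and H *)
pose th (x : L * K * 'I_7) := e (x.1.1, x.2).
pose spec x y (c : L * K) := exists b d f,
  [/\ (b, (d, f)) \in family_pairs dat,
      entry_diff (d, f) = ((th x).1, (th y).1, (th x).2 - (th y).2, x.1.2 - y.1.2)%R
    & c = (b.1, x.1.2 - d.2)%R].
have spec_ex (xy : (L * K * 'I_7) * (L * K * 'I_7)) :
    exists c, xy.1.1.2 != xy.2.1.2 -> spec xy.1 xy.2 c.
  case: xy => x y /=; have [Exy|ne] := eqVneq x.1.2 y.1.2.
    by exists x.1.
  have := fullD ((th x).1, (th y).1, (th x).2 - (th y).2, x.1.2 - y.1.2)%R.
  rewrite -[RHS]topredE /= subr_eq0 ne => /mapP[[b [d f]] Db E].
  by exists (b.1, x.1.2 - d.2)%R => _; exists b, d, f.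
have [col0 colP] := fin_all_exists spec_ex.
pose col x y := col0 (x, y).
have {}colP x y : x.1.2 != y.1.2 -> spec x y (col x y) by apply: (colP (x, y)).
have colE x y c : x.1.2 != y.1.2 -> spec x y c -> col x y = c.
  move=> /colP[b [d [f [Db Eb ->]]]] [b' [d' [f' [Db' Eb' ->]]]].
  have [-> -> _] : (b, (d, f)) = (b', (d', f')) by apply: injD; rewrite // /diff_key /= Eb Eb'.
  by [].
exists col; split.
- move=> x y _ _ ne; have [b [d [f [Db Eb Ec]]]] := colP x y ne.
  move: (Db); rewrite pairP => /and4P[Bb Dd Df nf]; rewrite inE; split=> //.
    by rewrite Ec /= -subr_eq0 addrAC subrr sub0r oppr_eq0 (kn0 b).
  rewrite Ec; apply: colE; first by rewrite eq_sym.
  exists b, f, d; split; first by rewrite pairP Bb Dd Df eq_sym.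
    case: Eb => E1 E2 E3 E4; rewrite /entry_diff /= E1 E2.
    by rewrite -(opprB d.1.2) E3 -(opprB d.2) E4 !opprB.
  by case: Eb => _ _ _ /sub_swap ->.
- move=> x y z _ _ _ ne1 ne2 ne3.
  have [b [d [f [Db Eb ->]]]] := colP x y ne1.
  have [b' [d' [f' [Db' Eb' ->]]]] := colP x z ne2.
  move: (Db) (Db'); rewrite !pairP => /and4P[Bb Dd Df nf] /and4P[Bb' Dd' Df' nf'] [E1 E2].
  case: Eb Eb' => T1 T2 H1 K1 [T1' T2' H1' K1'].
  have [Ebb Edd] : (b, d) = (b', d').
    apply: injE; rewrite ?entP ?Bb ?Bb' // /entry_key /= E1 T1 T1'; congr (_, _).
    by apply/oppr_inj/(addrI x.1.2).
  subst b' d'; have nff : f != f'.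
    apply: contraNneq ne3 => Eff; subst f'.
    have Eth : th y = th z.
      rewrite [LHS]surjective_pairing [RHS]surjective_pairing -T2 T2'; congr pair.
      by apply/oppr_inj/(addrI (th x).2); rewrite -H1.
    have /(addrI x.1.2)/oppr_inj Ek : (x.1.2 - y.1.2 = x.1.2 - z.1.2)%R by rewrite -K1.
    move/(can_inj eK): Eth.
    case: y z Ek {ne1 ne2 T2 H1 K1 T2' H1' K1' Db Db'} => [[? ?] ?] [[? ?] ?] /=.
    by move=> -> [-> ->].
  have ned : f.2 != f'.2 by apply: (kne b).
  have Kyz : (f.2 - f'.2 = y.1.2 - z.1.2)%R by apply: sub_sub K1 K1'.
  have neyz : y.1.2 != z.1.2 by rewrite -subr_eq0 -Kyz subr_eq0.
  split=> //; apply: colE => //; exists b, f, f'; split; first by rewrite pairP Bb Df Df'.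
    by rewrite /entry_diff /= T2 T2' Kyz (sub_sub _ _ _ _ _ _ _ H1 H1').
  by rewrite (sub_swap _ _ _ _ _ K1).
- move=> x [l t] _ _ /= ne.
  have := fullE (l, (th x).1, x.1.2 - t)%R.
  rewrite -[RHS]topredE /= subr_eq0 eq_sym ne => /mapP[[b d]].
  rewrite entP => /andP[/= Bb Dd] [El Et Ek].
  have /andP[/eqP s8 ub] := sz8 b Bb.
  (* the entry f, under the translation that sends the entry d to x *)
  pose pt (f : T * H * K) : L * K * 'I_7 :=
    let lj := e' (f.1.1, f.1.2 + ((th x).2 - d.1.2))%R in ((lj.1, f.2 + t)%R, lj.2).
  have thpt f : th (pt f) = (f.1.1, f.1.2 + ((th x).2 - d.1.2))%R.
    by rewrite /th /pt /= -surjective_pairing eK'.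
  have pt_inj : injective pt.
    move=> f f' Ef; have := congr1 th Ef; rewrite !thpt => -[E1 /addIr E2].
    have /addIr E3 := congr1 (fun p : L * K * 'I_7 => p.1.2) Ef.
    by case: f f' E1 E2 E3 {Ef} => [[? ?] ?] [[? ?] ?] /= -> -> ->.
  have xk : x.1.2 = (d.2 + t)%R by rewrite -Ek subrK.
  have -> : [set y : L * K * 'I_7 | [&& y.1 \in setT, y.1.2 != x.1.2 & col x y == (l, t)]] =
      [set y in [seq pt f | f <- rem d b.2]].
    apply/setP => y; rewrite !inE /=; apply/idP/mapP.
      case/andP=> ne1 /eqP Ec; rewrite eq_sym in ne1.
      have [b' [d' [f [Db [T1 T2 H1 K1] Ec']]]] := colP x y ne1.
      move: (Db); rewrite pairP => /and4P[Bb' Dd' Df nf]; move: Ec'; rewrite Ec => -[El' Et'].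
      have [Ebb Edd] : (b', d') = (b, d).
        apply: injE; rewrite ?entP ?Bb ?Bb' // /entry_key /= -El -El' T1 -Et -Ek Et'.
        by rewrite subKr.
      subst b' d'; exists f; first by rewrite mem_rem_uniq // inE eq_sym nf.
      have Eth : th y = th (pt f).
        rewrite thpt [LHS]surjective_pairing T2; congr pair.
        by rewrite (sub_swap _ _ _ _ _ H1) addrC subrK.
      move: Eth => /(can_inj eK).
      have : y.1.2 = (f.2 + t)%R by rewrite Et' (sub_swap _ _ _ _ _ K1) addrC subrK.
      by case: y {ne1 Ec T2 H1 K1} => [[? ?] ?] /= -> [-> ->].
    case=> f; rewrite mem_rem_uniq // inE => /andP[nf Df] ->.
    have ne1 : x.1.2 != (pt f).1.2.
      by rewrite /= xk (inj_eq (addIr _)) eq_sym; apply: (kne b).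
    rewrite eq_sym ne1 /=; apply/eqP/colE => //; exists b, d, f; split.
    - by rewrite pairP Bb Dd Df eq_sym.
    - rewrite thpt /entry_diff /= Et xk; congr (_, _, _, _).
        by rewrite opprD opprB addrCA [X in _ = (_ + X)%R]addrC subrK addrC.
      by rewrite opprD addrACA subrr addr0.
    by rewrite El xk addrAC subrr add0r.
  rewrite cardsE; have /card_uniqP -> : uniq [seq pt f | f <- rem d b.2].
    by rewrite map_inj_uniq // rem_uniq.
  by rewrite size_map size_rem // s8.
Qed.

(** * Small frames *)

HB.instance Definition _ (U V : finZmodType) := GRing.Zmodule.on (U * V)%type.

(** A base block symmetric under [k |-> - k], from half of its entries. *)
Definition mirror (T : Type) (H K : zmodType) (s : seq (T * H * K)) :=
  s ++ [seq (d.1, - d.2)%R | d <- s].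

(** A frame of type [7^n] with a group of automorphisms [Z_7 * K] that is
    regular on the points. *)
Lemma frame7_of_family7 (K : finZmodType)
    (dat : seq ('I_1 * seq ('I_1 * 'I_7 * K))) :
  frame_family (7 * #|K|.-1) #|K|.-1 dat -> frame7 #|K|.
Proof.
move=> fam; have <- : #|{: 'I_1 * K}| = #|K| by rewrite card_prod card_ord mul1n.
apply: (@frame7_of_frame _ _ snd); first by move=> [i ?] [j ?] /= ->; rewrite !ord1.
apply: (@frame_of_family _ _ _ _ id dat); first by exists id.
by rewrite !card_ord !mul1n.
Qed.

(** A frame of type [7^n] with a group of automorphisms [K] that is regular on
    the groups and has 7 orbits on the points. *)
Lemma frame7_of_family_orbits (K : finZmodType)
    (dat : seq ('I_1 * seq ('I_7 * 'I_1 * K))) :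
  frame_family (49 * #|K|.-1) (7 * #|K|.-1) dat -> frame7 #|K|.
Proof.
move=> fam; have <- : #|{: 'I_1 * K}| = #|K| by rewrite card_prod card_ord mul1n.
apply: (@frame7_of_frame _ _ snd); first by move=> [i ?] [j ?] /= ->; rewrite !ord1.
apply: (@frame_of_family _ _ _ _ (fun p => (p.2, p.1)) dat).
  by exists (fun p => (p.2, p.1)) => -[].
by rewrite !card_ord muln1 mul1n.
Qed.

(** Symmetric base blocks over [Z_{n+1}] with 7 point orbits. *)
Definition orbit_family (n : nat) (l : seq (seq (nat * nat))) :
    seq ('I_1 * seq ('I_7 * 'I_1 * 'I_n.+1)) :=
  [seq (ord0, mirror [seq (inZp p.1, ord0, inZp p.2) | p <- s]) | s <- l].

Lemma frame7_9 : frame7 9.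
Proof.
rewrite -[9]card_ord; apply: (frame7_of_family7
  (dat := [:: (ord0, mirror [seq (ord0, inZp p.1, inZp p.2)
     | p <- [:: (0, 1); (1, 2); (6, 3); (3, 4)]])])).
by rewrite card_ord; vm_compute.
Qed.

(** For [q] a power of 2, the points of the affine plane [F_{q^2}] over [F_q]
    whose norm is a nonzero element of an additive subgroup of order 8 of [F_q]
    form, with the origin, a Denniston maximal arc of degree 8.  The lines
    through the origin are the groups, the other lines meeting the arc the
    blocks, and the directions the classes.  The elements of norm 1, a cyclic
    group of order [q + 1], permute the groups regularly; an entry [(i, k)]
    stands for the product of the element of [F_q] whose norm is the [i]-th one
    by the [k]-th power of a generator of that group. *)
Lemma frame7_17 : frame7 17.
Proof.
rewrite -[17]card_ord; apply: (frame7_of_family_orbits (dat := @orbit_family 16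
     [:: [:: (0, 1); (4, 3); (1, 6); (5, 7)]; [:: (0, 2); (6, 3); (4, 5); (2, 6)];
         [:: (5, 2); (0, 3); (2, 4); (3, 7)]; [:: (0, 4); (3, 5); (5, 6); (2, 7)];
         [:: (1, 1); (0, 5); (4, 6); (5, 8)]; [:: (1, 3); (6, 4); (0, 6); (3, 8)];
         [:: (6, 1); (4, 2); (2, 5); (0, 7)]; [:: (3, 3); (6, 5); (1, 7); (0, 8)];
         [:: (2, 1); (1, 2); (5, 4); (6, 6)]; [:: (5, 1); (1, 4); (6, 7); (2, 8)];
         [:: (4, 1); (2, 3); (3, 4); (1, 5)]; [:: (2, 2); (3, 6); (4, 7); (1, 8)];
         [:: (3, 1); (6, 2); (5, 3); (4, 8)]; [:: (3, 2); (4, 4); (5, 5); (6, 8)]])).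
by rewrite card_ord; vm_compute.
Qed.

(** The same construction with [q = 32]. *)
Lemma frame7_33 : frame7 33.
Proof.
rewrite -[33]card_ord; apply: (frame7_of_family_orbits (dat := @orbit_family 32
     [:: [:: (0, 1); (1, 4); (6, 8); (3, 13)]; [:: (0, 2); (5, 4); (3, 6); (2, 7)];
         [:: (0, 3); (4, 7); (1, 9); (5, 15)]; [:: (0, 4); (4, 5); (6, 10); (2, 12)];
         [:: (2, 1); (0, 5); (5, 6); (3, 10)]; [:: (0, 6); (3, 7); (6, 9); (1, 14)];
         [:: (0, 7); (4, 9); (5, 12); (1, 16)]; [:: (0, 8); (1, 10); (6, 12); (3, 15)];
         [:: (5, 1); (1, 2); (0, 9); (4, 16)]; [:: (3, 1); (5, 7); (0, 10); (2, 13)];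
         [:: (5, 2); (3, 5); (2, 10); (0, 11)]; [:: (4, 1); (0, 12); (6, 13); (2, 14)];
         [:: (2, 2); (4, 8); (0, 13); (6, 15)]; [:: (6, 2); (0, 14); (1, 15); (3, 16)];
         [:: (1, 1); (5, 11); (4, 12); (0, 15)]; [:: (4, 2); (2, 3); (6, 6); (0, 16)];
         [:: (1, 3); (2, 4); (6, 11); (5, 14)]; [:: (4, 4); (1, 5); (3, 8); (2, 15)];
         [:: (6, 3); (1, 6); (2, 11); (5, 13)]; [:: (4, 3); (2, 5); (1, 7); (3, 11)];
         [:: (1, 8); (4, 13); (3, 14); (2, 16)]; [:: (6, 4); (2, 8); (5, 9); (1, 11)];
         [:: (3, 2); (2, 6); (1, 12); (4, 15)]; [:: (5, 5); (2, 9); (1, 13); (6, 14)];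
         [:: (3, 3); (4, 6); (6, 7); (5, 8)]; [:: (3, 4); (6, 5); (4, 11); (5, 16)];
         [:: (3, 9); (5, 10); (4, 14); (6, 16)]; [:: (6, 1); (5, 3); (4, 10); (3, 12)]])).
by rewrite card_ord; vm_compute.
Qed.

Lemma frame7_49 : frame7 49.
Proof.
(* (a, b) stands for a + b w in F_49 with w primitive, w^2 = w + 4, and mu is
   the multiplication by w^4; the powers w^(4 i), i < 6, represent the fourth
   powers up to sign. *)
pose mu (k : 'I_7 * 'I_7) := (k.1 *+ 6 + k.2, k.1 *+ 2 + k.2)%R.
have <- : #|{: 'I_7 * 'I_7}| = 49 by rewrite card_prod !card_ord.
apply: (frame7_of_family7 (dat := [seq (ord0, mirror
    [seq (ord0, inZp p.1, iter i mu (inZp p.2.1, inZp p.2.2))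
      | p <- [:: (0, (1, 0)); (1, (4, 1)); (2, (3, 4)); (4, (1, 1))]]) | i <- iota 0 6])).
by rewrite card_prod !card_ord; vm_compute.
Qed.

Lemma frame7_89 : frame7 89.
Proof.
(* 2 has order 11 modulo 89, and the second components of the entries represent
   the cosets of the subgroup it generates. *)
rewrite -[89]card_ord; apply: (frame7_of_family7 (dat := [seq (ord0,
    [seq (ord0, inZp p.1, inZp (p.2 * 2 ^ i))
      | p <- [:: (0, 1); (0, 20); (1, 14); (1, 58); (2, 18); (2, 61); (4, 26); (4, 73)]])
      | i <- iota 0 11])).
by rewrite card_ord; vm_compute.
Qed.

Lemma frame7_97 : frame7 97.
Proof.
(* 43 generates the fourth powers modulo 97, and its powers with exponent less
   than 12 represent them up to sign. *)
pose mu (k : 'I_97) : 'I_97 := inZp (43 * k).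
rewrite -[97]card_ord; apply: (frame7_of_family7 (dat := [seq (ord0, mirror
    [seq (ord0, inZp p.1, iter i mu (inZp p.2))
      | p <- [:: (0, 1); (1, 7); (2, 21); (4, 48)]]) | i <- iota 0 12])).
by rewrite card_ord; vm_compute.
Qed.

Definition bits3 (n : nat) : 'I_2 * ('I_2 * 'I_2) :=
  (inZp n, (inZp n./2, inZp n./2./2)).

(** The elementary abelian group of order 8, seen in the difference matrix below
    as [F_2[x] / (x^3 + x + 1)]. *)
Definition L8 : finZmodType := ('I_2 * ('I_2 * 'I_2))%type.

(** Entry [(p, q, k)] over [Z_7], [L8] and [F_25]: [q] is coded in binary, and
    [k = a + 5 b] codes [a + b w], where [w^2 = w + 3]. *)
Definition entry25 (d : nat * nat * nat) : 'I_1 * (L8 * 'I_7) * ('I_5 * 'I_5) :=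
  (ord0, (bits3 d.1.2, inZp d.1.1), (inZp d.2, inZp (d.2 %/ 5))).

(** An automorphism of order 12: multiplication by 3 in [Z_7], a unipotent map
    of order 4 on [L8], and multiplication by [w^2] in [F_25]. *)
Definition alpha25 (d : 'I_1 * (L8 * 'I_7) * ('I_5 * 'I_5)) :
    'I_1 * (L8 * 'I_7) * ('I_5 * 'I_5) :=
  let: (i, ((x, (y, z)), p), (a, b)) := d in
  (i, ((x + y, (y + z, z)), p *+ 3), ((a + b) *+ 3, a + b *+ 4))%R.

(** The base blocks are the images under [alpha25] of three blocks.  The last
    two are invariant under [alpha25^6] up to translation, hence have 6 images.
    The components in [F_25] of the 8 entries represent the cosets of the
    subgroup of order 3 (respectively, up to sign, those of order 6), which
    explains the labels. *)
Definition family25 : seq (L8 * seq ('I_1 * (L8 * 'I_7) * ('I_5 * 'I_5))) :=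
  [seq (bits3 (i %% 4), map (iter i alpha25) (map entry25
     [:: (6, 0, 11); (3, 5, 16); (5, 3, 24); (0, 7, 15);
         (1, 0, 4); (3, 1, 14); (2, 1, 2); (0, 1, 7)])) | i <- iota 0 12] ++
  [seq (bits3 (4 + i %% 2), map (iter i alpha25) (map entry25
     [:: (6, 3, 14); (6, 3, 16); (3, 1, 2); (3, 1, 3);
         (5, 7, 13); (5, 6, 17); (2, 4, 1); (2, 5, 4)])) | i <- iota 0 6] ++
  [seq (bits3 (6 + i %% 2), map (iter i alpha25) (map entry25
     [:: (6, 3, 14); (6, 1, 16); (4, 3, 13); (4, 1, 17);
         (6, 5, 2); (6, 6, 3); (1, 6, 12); (1, 5, 18)])) | i <- iota 0 6].

(** A frame of type [56^25], whose groups are filled with frames of type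
    [7^9]. *)
Lemma frame7_201 : frame7 201.
Proof.
have cL : #|L8| = 8 by rewrite !card_prod !card_ord.
have cK : #|{: 'I_5 * 'I_5}| = 25 by rewrite card_prod !card_ord.
have fr : has_frame [set: L8 * ('I_5 * 'I_5)] snd.
  apply: (@frame_of_family _ _ _ _ (fun p => (ord0, p)) family25).
    by exists snd => // -[i p]; rewrite (ord1 i).
  by rewrite cK card_prod cL !card_ord; vm_compute.
have := frame7_fill fr; rewrite card_prod cL cK; apply=> k.
have -> : [set c : L8 * ('I_5 * 'I_5) | c.2 == k] = setX [set: L8] [set k].
  by apply/setP => c; rewrite !inE.
by rewrite cardsX cardsT cL cards1; apply: frame7_9.
Qed.

(** * Lines of a strip in an affine plane *)

Lemma line_inj (F : fieldType) (s s' c c' a b : F) : a != b ->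
  (s * a + c = s' * a + c' -> s * b + c = s' * b + c' -> s = s' /\ c = c')%R.
Proof.
move=> nab E1 E2; have Es : s = s'.
  apply: (mulIf (_ : a - b != 0)%R); first by rewrite subr_eq0.
  have D (t d : F) : (t * (a - b) = t * a + d - (t * b + d))%R.
    by rewrite mulrBr opprD addrACA subrr addr0.
  by rewrite (D s c) E1 E2 -D.
by split=> //; move: E1; rewrite Es => /addrI.
Qed.

Lemma line_ex (F : fieldType) (a b x y : F) : a != b ->
  exists s c, (x = s * a + c)%R /\ (y = s * b + c)%R.
Proof.
rewrite -subr_eq0 => nab; exists ((x - y) / (a - b))%R, (x - (x - y) / (a - b) * a)%R.
split; first by rewrite addrC subrK.
by rewrite addrCA -mulrBr -(opprB a) mulrN divfK // opprB addrC subrK.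
Qed.

(** The vertical lines of the strip [S * F] have [#|F|] points, and the other
    lines have [#|S|] points. *)
Lemma frame7_strip (F : finFieldType) (S : {set F}) :
  frame7 #|S| -> frame7 #|F| -> frame7 (#|S| * #|F|).
Proof.
move=> FS FF; pose S' : finType := {x : F | x \in S}.
have cS : #|S'| = #|S| by rewrite card_sig; apply: eq_card => x; rewrite inE.
rewrite -cS -card_prod.
pose line (b : S' + F * F) : {set S' * F} := match b with
  | inl x => [set p | p.1 == x]
  | inr (s, c) => [set p | p.2 == s * val p.1 + c]%R
  end.
apply: (@frame7_pbd _ _ line).
- move=> [a x] [b y] ne; have [Eab|nab] := eqVneq a b.
    by exists (inl a); rewrite !inE /= Eab !eqxx.
  have [s [c [-> ->]]] := line_ex x y (nab : val a != val b).
  by exists (inr (s, c)); rewrite !inE /= !eqxx.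
- move=> [c|[s c]] [c'|[s' c']] [a x] [b y] ne; rewrite !inE /=.
  + by move=> /eqP <- _ /eqP <-.
  + move=> /eqP Ea /eqP Eb /eqP Ex /eqP Ey; move: ne.
    by rewrite Ex Ey Ea Eb eqxx.
  + move=> /eqP Ex /eqP Ey /eqP Ea /eqP Eb; move: ne.
    by rewrite Ex Ey Ea Eb eqxx.
  + move=> /eqP Ex /eqP Ey /eqP Ex' /eqP Ey'.
    have nab : a != b by apply: contraNneq ne => Eab; rewrite Ex Ey Eab.
    by have [|-> ->] := line_inj (nab : val a != val b) (etrans (esym Ex) Ex'); rewrite -?Ey.
- case=> [a|[s c]].
    have -> : line (inl a) = setX [set a] [set: F].
      by apply/setP => p; rewrite !inE andbT.
    by rewrite cardsX cards1 cardsT mul1n.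
  have -> : line (inr (s, c)) = [set (x, s * val x + c)%R | x : S'].
    apply/setP => -[x y]; rewrite !inE /=; apply/eqP/imsetP => [->|[x' _ [-> ->]] //].
    by exists x.
  by rewrite card_imset ?cS // => x y [].
Qed.

(** * Inflation by difference matrices of orders 8 and 48 *)

Lemma exists_finField (p k : nat) :
  prime p -> 0 < k -> exists F : finFieldType, #|F| = p ^ k.
Proof. by move=> pp k0; have [F _ cF] := PrimePowerField pp k0; exists F. Qed.

(** Multiplication by [x] and Frobenius map on [L8 = F_2[x] / (x^3 + x + 1)]. *)
Definition gamma8 (f : L8) : L8 := let: (a, (b, c)) := f in (c, (a + c, b))%R.
Definition frob8 (f : L8) : L8 := let: (a, (b, c)) := f in (a, (c, b + c))%R.

(** The group underlying the difference matrix of order 48. *)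
Definition G48 : finZmodType := (L8 * 'I_6)%type.

Definition twist48 (d : G48) : G48 := (frob8 d.1, d.2 + inZp 2)%R.
(** A column is coded by [y : Z_7 -> G48]: its entries are 0 and then
    [gamma8^i (y_i)] for [i] in [Z_7], where [gamma8] acts on [L8].  The set of
    columns is stable under rotation of the indices, and under the map [theta48]
    that sends [y] to the [y'] such that [y'_{2i}] is the twist of [y_i]; in
    [theta48], 4 is the inverse of 2 modulo 7. *)
Definition theta48 (y : seq G48) : seq G48 :=
  [seq twist48 (nth 0%R y (4 * j %% 7)) | j <- iota 0 7].
Definition column48 (y : seq G48) : seq G48 :=
  0%R :: [seq (iter i gamma8 (nth 0%R y i).1, (nth 0%R y i).2) | i <- iota 0 7].
Definition elt48 (p : nat * nat) : G48 := (bits3 p.1, inZp p.2).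

(** Two orbits of 21 columns, and two orbits of 3 columns with constant [y]. *)
Definition columns48 : seq (seq G48) :=
  [seq column48 (rotr j y) | y <- [seq iter t theta48 (map elt48 y) | y <-
       [:: [:: (0,0); (1,3); (4,4); (7,2); (6,3); (6,5); (7,1)];
           [:: (2,3); (2,4); (1,2); (3,5); (0,5); (3,1); (7,0)]],
       t <- iota 0 3], j <- iota 0 7] ++
  [seq column48 (iter t theta48 (nseq 7 (elt48 p))) | p <- [:: (2,0); (3,0)], t <- iota 0 3].

(** A difference matrix given by the list of its columns. *)
Lemma difference_matrix_seq (G : finZmodType) (cols : seq (seq G)) :
  size cols = #|G| ->
  all (fun r => all (fun r' => (r == r') ||
    uniq [seq (nth 0 c r - nth 0 c r')%R | c <- cols]) (iota 0 8)) (iota 0 8) ->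
  exists D : 'I_8 -> G -> G,
    forall r r', r != r' -> injective (fun s => D r s - D r' s)%R.
Proof.
move=> sz ok; exists (fun r s => nth 0%R (nth [::] cols (enum_rank s)) r).
move=> r r' ne s s' /= E.
have := allP (allP ok r _) r' _; rewrite !mem_iota !ltn_ord => /(_ isT isT).
rewrite (inj_eq val_inj) (negPf ne) => u.
have lt (x : G) : enum_rank x < size cols by rewrite sz.
have := nth_uniq 0%R _ _ u; rewrite size_map => /(_ _ _ (lt s) (lt s')).
by rewrite !(nth_map [::]) // E eqxx (inj_eq val_inj) (inj_eq enum_rank_inj) => /esym/eqP.
Qed.

Lemma card_G48 : #|G48| = 48.
Proof. by rewrite !card_prod !card_ord. Qed.

Lemma difference_matrix48 : exists D : 'I_8 -> G48 -> G48,
  forall r r', r != r' -> injective (fun s => D r s - D r' s)%R.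
Proof.
by apply: (@difference_matrix_seq _ columns48); [rewrite card_G48|]; vm_compute.
Qed.

Lemma frame7_817 : frame7 817.
Proof.
have [D DP] := difference_matrix48; have fr := frame_inflate DP frame7_17.
have c48 := card_G48.
have := frame7_fill fr; rewrite card_prod c48 card_ord; apply=> i.
have -> : [set c : 'I_17 * G48 | c.1 == i] = setX [set i] [set: G48].
  by apply/setP => c; rewrite !inE andbT.
by rewrite cardsX cards1 cardsT c48; apply: frame7_49.
Qed.

(** The multiplication table of the field of order 8 is a difference matrix. *)
Lemma frame_inflate8 (I W : finType) : #|W| = 8 -> frame7 #|I| ->
  has_frame [set: I * W] fst.
Proof.
move=> cW FI; have [G cG] := exists_finField (isT : prime 2) (isT : 0 < 3).
have {}FI : has_frame [set: I] id by apply: frame7_set; rewrite cardsT.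
have c8 : #|'I_8| = #|G| by rewrite card_ord cG.
pose D (r : 'I_8) (s : G) : G := (enum_val (cast_ord c8 (enum_rank r)) * s)%R.
have fr : has_frame [set: I * G] fst.
  apply: (@frame_inflate I G D) FI => r r' ne s s' /=; rewrite /D -!mulrBl.
  apply: mulfI; rewrite subr_eq0; apply: contraNneq ne.
  by move/enum_val_inj/cast_ord_inj/enum_rank_inj ->.
have cGW : #|G| = #|W| by rewrite cW cG.
pose w (s : G) : W := enum_val (cast_ord cGW (enum_rank s)).
have w_inj : injective w by move=> s s' /enum_val_inj/cast_ord_inj/enum_rank_inj.
pose f (c : I * G) := (c.1, w c.2).
have f_inj : injective f by move=> [? ?] [? ?] [-> /w_inj ->].
suff <- : [set f c | c : I * G] = [set: I * W] by apply: frame_transport fr.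
apply/eqP; rewrite eqEcard subsetT cardsT card_imset //.
by rewrite /= !card_prod cGW leqnn.
Qed.

(** * Truncated transversal designs *)

Lemma exists_subset (T : finType) (x0 : T) (k : nat) :
  0 < k <= #|T| -> exists2 S : {set T}, x0 \in S & #|S| = k.
Proof.
case: k => // k; rewrite cardE => kT.
have ux : uniq (take k (rem x0 (enum T))) by rewrite take_uniq ?rem_uniq ?enum_uniq.
have nx : x0 \notin take k (rem x0 (enum T)).
  by apply/negP => /mem_take; rewrite mem_rem_uniq ?enum_uniq // !inE eqxx.
exists [set x in x0 :: take k (rem x0 (enum T))]; first by rewrite !inE eqxx.
rewrite cardsE; have /card_uniqP -> : uniq (x0 :: take k (rem x0 (enum T))) by rewrite /= nx.
by rewrite /= size_takel // size_rem ?mem_enum // -ltnS prednK // (leq_trans _ kT).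
Qed.

(** [F] indexes the first groups of the transversal design and [E] the points of
    each of them; [U] is the truncated last group. *)
Section Master.
Variables (F E : finFieldType) (S : {set F}) (U : {set E}) (lam : F -> E).
Hypotheses (S0 : 0%R \in S) (cS : #|S| = 9) (lam_inj : injective lam).
Hypotheses (F9 : frame7 9) (FF : frame7 #|F|).

Let S' : finType := {a : F | (a \in S) && (a != 0)%R}.
Let N : finType := {y : F | (y != 0)%R}.
Let U' : finType := {u : E | u \in U}.

Let cS' : #|S'| = 8.
Proof.
have <- : #|S :\ 0%R| = 8.
  by apply/eqP; rewrite -(eqn_add2l 1) -{1}[1]/(nat_of_bool true) -S0 -cardsD1 cS.
by rewrite card_sig; apply: eq_card => a; rewrite !inE andbC.
Qed.

Let cN : #|N| = #|F|.-1.
Proof. by rewrite -(cardsC1 (0 : F)%R) card_sig; apply: eq_card => a; rewrite !inE. Qed.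

(** The points of the strip [S * F] other than the origin: [inl (k, a)] is the
    point [(a, k a)], of the line of slope [k] through the origin, and [inr y]
    is the point [(0, y)].  The lines through the origin are the groups. *)
Let strip_group (c : F * S' + N) : option F := if c is inl p then Some p.1 else None.

Let S'n0 (a : S') : val a != 0%R. Proof. by case/andP: (valP a). Qed.

(** The blocks are the lines of the strip that avoid the origin: [inl a] is the
    vertical line of abscissa [a], with [#|F|] points, and [inr (s, c)] the line
    [y = s x + c], with 9 points. *)
Lemma frame_strip : has_frame [set: F * S' + N] strip_group.
Proof.
pose line (b : S' + F * N) : {set F * S' + N} := match b with
  | inl a => [set c | if c is inl p then p.2 == a else false]
  | inr (s, c) => [set p | match p with
      | inl (k, a) => (k * val a == s * val a + val c)%R
      | inr y => y == c end]
  end.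
have neq_a k k' (a a' : S') s (c : N) : k != k' ->
    (k * val a = s * val a + val c)%R -> (k' * val a' = s * val a' + val c)%R ->
    val a != val a'.
  move=> ne E1 E2; apply: contraNneq ne => Ea; rewrite Ea in E1.
  by apply/eqP/(mulIf (S'n0 a')); rewrite E1 E2.
apply: (@frame_wilson _ _ _ _ id strip_group line).
- move=> [a|[s c]] [[k b]|y] [[k' b']|y']; rewrite !inE //=.
  + by move=> /eqP -> /eqP -> [->].
  + move=> /eqP E1 /eqP E2 [Ek]; subst k'; congr (inl (_, _)); apply: val_inj.
    have ks : (k - s)%R != 0%R.
      rewrite subr_eq0; apply: contraNneq (valP c) => Eks.
      by move: E1; rewrite Eks -[LHS]addr0 => /addrI/esym/eqP.
    apply: (mulfI ks); rewrite !mulrBl E1 E2.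
    by rewrite ![(s * _ + _)%R]addrC !addrK.
  + by move=> /eqP -> /eqP ->.
- have mixed k (a : S') (y : N) : exists b, (inl (k, a) \in line b) && (inr y \in line b).
    exists (inr ((k - val y / val a)%R, y)); rewrite !inE eqxx andbT.
    by rewrite mulrBl divfK // subrK.
  move=> [[k a]|y] [[k' a']|y'] /= ne.
  + have [<-|na] := eqVneq a a'; first by exists (inl a); rewrite !inE !eqxx.
    have nk : k != k' by apply: contraNneq ne => ->.
    have [s [c [E1 E2]]] := line_ex (k * val a)%R (k' * val a')%R (na : val a != val a').
    have nc : c != 0%R.
      apply: contraNneq nk => Ec; rewrite Ec !addr0 in E1 E2.
      by rewrite (mulIf (S'n0 a) E1) (mulIf (S'n0 a') E2).
    by exists (inr (s, Sub c nc)); rewrite !inE /= E1 E2 !eqxx.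
  + exact: mixed.
  + by have [b] := mixed k' a' y; exists b; rewrite andbC.
  + by [].
- move=> b b' x y; wlog: x y / if x is inl _ then true else false.
    move=> W; case: x => [p|z]; first exact: W.
    case: y => [p|z']; last by rewrite eqxx.
    by rewrite eq_sym => *; apply: (W (inl p) (inr z)).
  case: x => [[k a]|] // _ ne.
  have ne' k' a' : y = inl (k', a') -> k != k'.
    by move=> Ey; apply: contraNneq ne => ->; rewrite Ey.
  case: b b' y ne ne' => [b|[s c]] [b'|[s' c']] [[k' a']|y] ne ne'; rewrite !inE //=.
  + by move=> /eqP <- _ /eqP <-.
  + move=> /eqP Ea /eqP Ea' /eqP E1 /eqP E2.
    by have := neq_a _ _ _ _ _ _ (ne' _ _ erefl) E1 E2; rewrite Ea Ea' eqxx.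
  + move=> /eqP E1 /eqP E2 /eqP Ea /eqP Ea'.
    by have := neq_a _ _ _ _ _ _ (ne' _ _ erefl) E1 E2; rewrite Ea Ea' eqxx.
  + move=> /eqP E1 /eqP E2 /eqP E1' /eqP E2'.
    have na := neq_a _ _ _ _ _ _ (ne' _ _ erefl) E1 E2.
    by have [|-> /val_inj ->] := line_inj na (etrans (esym E1) E1'); rewrite -?E2.
  + move=> /eqP E1 /eqP -> /eqP E1' /eqP Ec; subst c'.
    by move: E1; rewrite E1' => /addIr/(mulIf (S'n0 a)) ->.
- move=> b; have -> : [set c | id c \in line b] = line b by apply/setP => c; rewrite inE.
  apply: frame7_set; case: b => [a|[s c]].
    have -> : line (inl a) = [set inl (k, a) | k : F].
      apply/setP => -[[k a']|y]; rewrite !inE /=; last by apply/esym/imsetP => -[].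
      apply/eqP/imsetP => [->|[k' _ [_ ->]] //]; by exists k.
    by rewrite card_imset // => k k' [].
  have -> : line (inr (s, c)) =
      inr c |: [set inl (s + val c / val a, a)%R | a : S'].
    apply/setP => -[[k a]|y]; rewrite !inE /=; last first.
      by case: imsetP => [[]//|_]; rewrite orbF.
    apply/eqP/imsetP => [E1|[a' _ [-> ->]]]; last by rewrite mulrDl divfK ?S'n0.
    exists a => //; congr (inl (_, _)); apply: (mulIf (S'n0 a)).
    by rewrite mulrDl divfK ?S'n0.
  rewrite cardsU1 card_imset ?cS' //; last by move=> a a' [].
  by rewrite (_ : _ \notin _) //; apply/imsetP => -[].
Qed.

(** The blocks of the transversal design are the graphs [v = lam k * m + c],
    completed in the last group by [m] when it belongs to [U]. *)
Lemma frame7_master :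
  frame7 (#|E| * 8).+1 -> frame7 (#|U| * #|F|.-1).+1 ->
  frame7 (#|F| * #|E| * 8 + #|U| * #|F|.-1).+1.
Proof.
move=> FE FU.
have cU' : #|U'| = #|U| by rewrite card_sig; apply: eq_card => u; rewrite inE.
pose C : finType := (F * E * S' + U' * N)%type.
have cC : #|C| = #|F| * #|E| * 8 + #|U| * #|F|.-1.
  by rewrite card_sum !card_prod cS' cN cU'.
pose p (c : C) : F * E + U' := match c with inl d => inl d.1 | inr d => inr d.1 end.
pose g (x : F * E + U') : option F := if x is inl kv then Some kv.1 else None.
pose block (b : E * E) : {set F * E + U'} :=
  [set x | match x with
           | inl (k, v) => (v == lam k * b.1 + b.2)%R
           | inr u => val u == b.1 end].
have fr : has_frame [set: C] (fun c => g (p c)).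
  apply: (@frame_wilson _ _ _ _ p g block).
  - move=> [m c] [[k v]|u] [[k' v']|u']; rewrite !inE //=.
      by move=> /eqP -> /eqP -> [->].
    by move=> /eqP E1 /eqP E2 _; congr inr; apply: val_inj; apply: etrans E1 (esym E2).
  - have mixed k v u : exists b, (inl (k, v) \in block b) && (inr u \in block b).
      by exists (val u, v - lam k * val u)%R; rewrite !inE /= addrC subrK !eqxx.
    move=> [[k v]|u] [[k' v']|u'] /= ne; last by [].
    + have nk : lam k != lam k' by rewrite (inj_eq lam_inj); apply: contraNneq ne => ->.
      have [m [c [-> ->]]] := line_ex v v' nk.
      by exists (m, c); rewrite !inE /= ![(_ * m)%R]mulrC !eqxx.
    + exact: mixed.
    + by have [b] := mixed k' v' u; exists b; rewrite andbC.
  - move=> [m c] [m' c'] [[k v]|u] [[k' v']|u'] ne; rewrite !inE //=.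
    + move=> /eqP E1 /eqP E2 /eqP E1' /eqP E2'.
      have nk : lam k != lam k' by rewrite (inj_eq lam_inj); apply: contraNneq ne => ->.
      rewrite ![(lam _ * _)%R]mulrC in E1 E2 E1' E2'.
      by have [|-> ->] := line_inj nk (etrans (esym E1) E1'); rewrite -?E2.
    + move=> /eqP E1 /eqP Em /eqP E1' /eqP Em'; subst m m'.
      by move: E1; rewrite E1' => /addrI ->.
    + move=> /eqP Em /eqP E1 /eqP Em' /eqP E1'; subst m m'.
      by move: E1; rewrite E1' => /addrI ->.
  - move=> [m c]; have [mU|mU] := boolP (m \in U); last first.
      (* a block that misses the last group *)
      pose f (d : F * S') : C := inl (d.1, (lam d.1 * m + c)%R, d.2).
      have f_inj : injective f by move=> [k a] [k' a'] [-> _ ->].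
      have -> : [set d | p d \in block (m, c)] = [set f d | d : F * S'].
        apply/setP => -[[[k v] a]|[u y]]; rewrite !inE /=; last first.
          rewrite (_ : (_ == _) = false); first by apply/esym/imsetP => -[].
          by apply: contraNF mU => /eqP <-; apply: valP.
        apply/eqP/imsetP => [->|[[k' a'] _ [-> -> _]] //].
        by exists (k, a).
      apply: (frame_transport f_inj _ (frame_inflate8 cS' FF)) => d d' /=.
      rewrite (inj_eq inl_inj) xpair_eqE /=.
      by case: eqVneq => // ->; rewrite eqxx.
    (* a block that meets the last group in m *)
    pose f (d : F * S' + N) : C := match d with
      | inl d => inl (d.1, (lam d.1 * m + c)%R, d.2)
      | inr y => inr (Sub m mU, y) end.
    have f_inj : injective f.
      by move=> [[k a]|y] [[k' a']|y'] //= => [[-> _ ->]|[->]].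
    have -> : [set d | p d \in block (m, c)] = [set f d | d : F * S' + N].
      apply/setP => -[[[k v] a]|[u y]]; rewrite !inE /=.
        apply/eqP/imsetP => [->|[[[k' a']|y] _ //= [-> -> _]] //].
        by exists (inl (k, a)).
      apply/eqP/imsetP => [Em|[[[k' a']|y'] _ //= [-> _]] //].
      by exists (inr y) => //; congr (inr (_, _)); apply: val_inj.
    apply: (frame_transport f_inj _ frame_strip) => -[[k a]|y] [[k' a']|y'] //=.
      rewrite (inj_eq inl_inj) (inj_eq Some_inj) xpair_eqE /=.
      by case: eqVneq => // ->; rewrite eqxx.
    by rewrite !eqxx.
rewrite -cC; apply: (frame7_fill fr) => -[k|].
  rewrite (_ : #|_| = #|E| * 8) //.
  pose f (d : E * S') : C := inl (k, d.1, d.2).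
  have f_inj : injective f by move=> [v a] [v' a'] [-> ->].
  rewrite -cS' -card_prod -(card_imset _ f_inj).
  apply: eq_card => -[[[k' v] a]|[u y]]; rewrite !inE /=; last by apply/esym/imsetP => -[].
  apply/eqP/imsetP => [[->]|[[v' a'] _ [-> _ _]] //].
  by exists (v, a).
rewrite (_ : #|_| = #|U| * #|F|.-1) //.
pose f (d : U' * N) : C := inr d.
have f_inj : injective f by move=> d d' [].
rewrite -cN -cU' -card_prod -(card_imset _ f_inj).
apply: eq_card => -[[[k' v] a]|d]; rewrite !inE /=; first by apply/esym/imsetP => -[].
by apply/esym/imsetP; exists d.
Qed.
End Master.

(** The order [e] of the second field only has to be large enough for the
    transversal design to exist. *)
Lemma frame7_truncated_td (pF kF pE kE u : nat) :
  prime pF -> 0 < kF -> prime pE -> 0 < kE ->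
  let q := pF ^ kF in let e := pE ^ kE in
  9 <= q <= e -> 0 < u <= e -> frame7 9 -> frame7 q ->
  frame7 (e * 8).+1 -> frame7 (u * q.-1).+1 -> frame7 (q * e * 8 + u * q.-1).+1.
Proof.
move=> pF_p kF_0 pE_p kE_0 q e /andP[q9 qe] ue F9 Fq Fe Fu.
have [F cF] := exists_finField pF_p kF_0; have [E cE] := exists_finField pE_p kE_0.
have [|S S0 cS] := @exists_subset F 0%R 9; first by rewrite cF.
have [|U _ cU] := @exists_subset E 0%R u; first by rewrite cE.
have le : #|F| <= #|E| by rewrite cF cE.
pose lam (k : F) : E := enum_val (widen_ord le (enum_rank k)).
have lam_inj : injective lam.
  by move=> k k' /enum_val_inj/(congr1 val) /= /val_inj/enum_rank_inj.
have := @frame7_master F E S U lam S0 cS lam_inj F9.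
by rewrite cF cE cU; apply.
Qed.

(** * The four orders *)

Lemma frame7_153 : frame7 153.
Proof.
have [F cF] := exists_finField (isT : prime 17) (isT : 0 < 1).
have [|S _ cS] := @exists_subset F 0%R 9; first by rewrite cF.
have := @frame7_strip F S; rewrite cS cF.
by apply; [apply: frame7_9 | apply: frame7_17].
Qed.

Lemma frame7_825 : frame7 825.
Proof.
exact: (@frame7_truncated_td 3 2 11 1 4 isT isT isT isT isT isT
          frame7_9 frame7_9 frame7_89 frame7_33).
Qed.

Lemma frame7_1457 : frame7 1457.
Proof.
exact: (@frame7_truncated_td 3 2 19 1 11 isT isT isT isT isT isT
          frame7_9 frame7_9 frame7_153 frame7_89).
Qed.

Lemma frame7_3497 : frame7 3497.
Proof.
exact: (@frame7_truncated_td 17 1 5 2 6 isT isT isT isT isT isT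
          frame7_9 frame7_17 frame7_201 frame7_97).
Qed.

Theorem theorem2p9 (v : nat) (hv : v \in [:: 5720; 5776; 10200; 24480]) :
  exists (T : finType) (A : seq {set T}), is_RBIBD v 8 1 A.
Proof.
have E n : v == (7 * n).+1 -> frame7 n ->
    exists (T : finType) (A : seq {set T}), is_RBIBD v 8 1 A.
  by move=> /eqP ->; apply: RBIBD_of_frame7.
move: hv; rewrite !inE => /or4P[] /eqP Ev.
- by apply: E frame7_817; rewrite Ev; vm_compute.
- by apply: E frame7_825; rewrite Ev; vm_compute.
- by apply: E frame7_1457; rewrite Ev; vm_compute.
- by apply: E frame7_3497; rewrite Ev; vm_compute.
Qed.
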